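(* Let $n\geq 4$ be an integer. There exist integers $s,t$ satisfying $1 \leq s < t \leq \lfloor n/2 \rfloor$ such that the graph $G(C_n, \{s,t\})$ contains a copy of $K_5$ if and only if $5$ divides $n$.
   Context: $C_n$ is the cycle with vertex set $\mathbb{Z}_n=\{0,1,\dots,n-1\}$, $i$ adjacent to $i\pm1 \pmod n$; the graph distance is $\mathrm{dist}(i,j)=\min(|i-j|,\,n-|i-j|)$. For a set $D$ of positive integers, the distance graph $G(C_n,D)$ has vertex set $\mathbb{Z}_n$, with distinct $i,j$ adjacent iff $\mathrm{dist}(i,j)\in D$. *)

(* Defs.v *)
From mathcomp Require Import all_boot.
Set Implicit Arguments.
Unset Strict Implicit.
Unset Printing Implicit Defensive.

(* A simple graph on a vertex type is a symmetric irreflexive boolean relation. *)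

(* With truncated subtraction, (i - j) + (j - i) is the absolute difference. *)
Definition absdiff (i j : nat) : nat := (i - j) + (j - i).

Definition cycle_dist (n : nat) (i j : 'I_n) : nat :=
  minn (absdiff i j) (n - absdiff i j).

Definition distance_graph (n : nat) (D : {pred nat}) : rel 'I_n :=
  fun i j => (i != j) && (cycle_dist i j \in D).

Definition complete_graph (m : nat) : rel 'I_m := fun i j => i != j.

(* A copy is a not necessarily induced subgraph. *)
Definition contains_copy (U V : finType) (H : rel U) (G : rel V) : Prop :=
  exists f : U -> V, injective f /\ (forall x y, H x y -> G (f x) (f y)).

Lemma distance_graph_sym n D : symmetric (@distance_graph n D).
Proof.
by move=> i j; rewrite /distance_graph eq_sym /cycle_dist /absdiff addnC.
Qed.

Lemma distance_graph_irr n D : irreflexive (@distance_graph n D).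
Proof. by move=> i; rewrite /distance_graph eqxx. Qed.

(* Main.v *)
Require Import Defs.
From mathcomp Require Import all_boot.
From mathcomp Require Import all_algebra zify.

Import GRing.Theory.

(** If [V] spans a K5, each [V - v] with [v] in [V] is a subset of size 5 of
    [S = {0, s, -s, t, -t}] in Z_n, hence equals [S]. Comparing the sums of the
    elements gives [sum V - 5 v = sum S], so [5 v] does not depend on [v]; since
    [V] has two distinct elements, 5 is not invertible mod [n]. Conversely,
    the multiples of [n / 5] form a K5 for [s = n / 5] and [t = 2 n / 5]. *)

Local Open Scope ring_scope.

Definition pm2_set {V : finZmodType} (a b : V) : {set V} :=
  [set:: [:: 0; a; - a; b; - b]].

Lemma mulrn5_const (V : finZmodType) (a b : V) (F : 'I_5 -> V) :
    injective F -> (forall x y, F y - F x \in pm2_set a b) ->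
  forall x x', F x *+ 5 = F x' *+ 5.
Proof.
move=> injF FS.
suff H x : F x *+ 5 = \sum_y F y - \sum_(z in pm2_set a b) z.
  by move=> x x'; rewrite !H.
have injG : injective (fun y => F y - F x) by move=> y z /addIr /injF.
have -> : pm2_set a b = [set F y - F x | y in 'I_5].
  apply/esym/eqP; rewrite eqEcard; apply/andP; split.
    by apply/subsetP => _ /imsetP[y _ ->]; apply: FS.
  (* The entries of [pm2_set] may coincide, for instance [b = - b], but a list of length 5 has at
     most 5 distinct elements. *)
  rewrite (card_imset _ injG) card_ord cardsE.
  exact: (leq_trans (card_size _)).
rewrite (big_imset _ (in2W injG)) /= big_split /= sumr_const card_ord mulNrn.
by rewrite opprD opprK addrA subrr add0r.
Qed.

(** Passes from distances to arithmetic in Z_n; the size [m.+2] gives ['I_m.+2] its ring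
    structure. *)
Lemma natr_cycle_dist (m : nat) (i j : 'I_m.+2) (d : nat) : cycle_dist i j = d ->
  i - j = d%:R \/ i - j = - d%:R.
Proof.
wlog le_ji : i j / (j <= i)%N => [IH | ].
  case/orP: (leq_total j i) => le_ij; first exact: IH.
  rewrite /cycle_dist /absdiff addnC => /(IH _ _ le_ij).
  by rewrite -(opprB j i) => -[->|->]; [right | left; rewrite opprK].
have Eij : i - j = (i - j)%N%:R by rewrite natrB // !natr_Zp.
have n0 : m.+2%:R = 0 :> 'I_m.+2 by apply: (pchar_Zp (p := m.+2)).
have lt_in := ltn_ord i.
rewrite /cycle_dist /absdiff => dE.
have [<-|dE'] : (i - j = d \/ i - j = m.+2 - d /\ d <= m.+2)%N by lia.
  by left.
by case: dE' => dE' le_dn; right; rewrite Eij dE' natrB // n0 add0r.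
Qed.

Lemma distance_graph_pm2 (m s t : nat) (i j : 'I_m.+2) :
  distance_graph (pred2 s t) i j -> i - j \in pm2_set (s%:R) (t%:R).
Proof.
by case/andP=> _ /orP[] /eqP /natr_cycle_dist[]->; rewrite !inE eqxx ?orbT.
Qed.

Lemma K5_distance_graph_dvd (m s t : nat) :
  contains_copy (@complete_graph 5) (distance_graph (pred2 s t) : rel 'I_m.+2) ->
  (5 %| m.+2)%N.
Proof.
case=> f [injf adj].
have FS x y : f y - f x \in pm2_set s%:R t%:R.
  (* The diagonal case is why [pm2_set] contains 0. *)
  have [->|neq] := eqVneq y x; first by rewrite subrr !inE eqxx.
  exact/distance_graph_pm2/adj.
have E := mulrn5_const _ _ _ f injf FS ord0 (lift ord0 ord0).
(* Otherwise the prime 5 is a unit mod n, and cancelling it in [E] identifies two distinct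
   vertices. *)
apply: contraT => /negP ndvd.
have co : coprime m.+2 5 by rewrite coprime_sym prime_coprime //; apply/negP.
have u5 : (5%:R : 'I_m.+2) \is a GRing.unit by rewrite (@unitZpE m.+2).
move: E; rewrite -[LHS]mulr_natr -[RHS]mulr_natr => /(mulIr u5) /injf.
by move/(congr1 val).
Qed.

Local Close Scope ring_scope.

(** Multiples of [k] form a copy of the 5-cycle scaled by [k], and distinct vertices of a 5-cycle
    are at distance 1 or 2. *)
Lemma K5_distance_graph_mul5 (k : nat) : 0 < k ->
  contains_copy (@complete_graph 5)
    (distance_graph (pred2 k (2 * k)) : rel 'I_(5 * k)).
Proof.
move=> k0.
have lt_f (i : 'I_5) : i * k < 5 * k by rewrite ltn_mul2r k0 /=.
have injf : injective (fun i : 'I_5 => Ordinal (lt_f i)).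
  by move=> i j /(congr1 val) /= /eqP; rewrite eqn_mul2r gtn_eqF //= => /eqP /val_inj.
exists (fun i => Ordinal (lt_f i)); split=> // i j neq.
apply/andP; split; first by rewrite (inj_eq injf).
move: neq; rewrite /complete_graph -val_eqE /cycle_dist /absdiff !inE /=.
(* With concrete indices each goal is linear in [k]. *)
by case: i j => [[|[|[|[|[|i]]]]] lti] [[|[|[|[|[|j]]]]] ltj] //= _; lia.
Qed.

Theorem theorem3p3p1 (n : nat) (hn : 4 <= n) :
  (exists s t : nat, [/\ 1 <= s, s < t, t <= n %/ 2 &
     contains_copy (@complete_graph 5) (@distance_graph n (pred2 s t))])
  <-> 5 %| n.
Proof.
split=> [[s [t [_ _ _]]] | /dvdnP[k nE]].
  by case: n hn => [|[|m]] // _; apply: K5_distance_graph_dvd.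
move: hn; rewrite {n}nE mulnC => hn; exists k, (2 * k).
by split; [lia | lia | lia | apply: K5_distance_graph_mul5; lia].
Qed.
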